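(* If $K$ is a convex body in $\mathbb{R}^n$ whose centroid is at the origin, then $-K\subset nK$.
   Context: A convex body in $\mathbb{R}^n$ is a compact convex set with nonempty interior. The centroid of $K$ is at the origin if $\int_K x\,dx=0$ (integration with respect to $n$-dimensional Lebesgue measure). $-K=\{-x:x\in K\}$ and $nK=\{nx:x\in K\}$. *)

(* Defs.v *)
From HB Require Import structures.
From mathcomp Require Import all_boot all_order all_algebra.
From mathcomp Require Import all_classical all_reals all_analysis.

Set Implicit Arguments.
Unset Strict Implicit.
Unset Printing Implicit Defensive.
Import Order.TTheory GRing.Theory Num.Theory.
Import numFieldNormedType.Exports.

Local Open Scope classical_set_scope.
Local Open Scope ring_scope.

Definition measure_rV_display : measure_display -> measure_display.
Proof. exact. Qed.

(* The sigma-algebra on row vectors generated by the coordinate functions, as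
   the library does for [n.-tuple T]. *)
Section measurable_rV.
Context {R : realType} (n : nat).

Let coors : 'I_n -> 'rV[R]_n -> R := fun i v => v 0 i.

Let rV_set0 : g_sigma_preimage coors set0.
Proof. exact: sigma_algebra0. Qed.

Let rV_setC A : g_sigma_preimage coors A -> g_sigma_preimage coors (~` A).
Proof. exact: sigma_algebraC. Qed.

Let rV_bigcup (F : (set 'rV[R]_n)^nat) :
  (forall i, g_sigma_preimage coors (F i)) ->
  g_sigma_preimage coors (\bigcup_i (F i)).
Proof. exact: sigma_algebra_bigcup. Qed.

HB.instance Definition _ :=
  @isMeasurable.Build (measure_rV_display default_measure_display) 'rV[R]_n
    (g_sigma_preimage coors) rV_set0 rV_setC rV_bigcup.

End measurable_rV.

Lemma measurable_coord {R : realType} n (i : 'I_n) :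
  measurable_fun [set: 'rV[R]_n] (fun v : 'rV[R]_n => v 0 i).
Proof.
move=> _ Y mY; rewrite setTI; apply: sub_sigma_algebra => /=.
rewrite -bigcup_seq/=; exists i => /=; first by rewrite mem_index_enum.
by exists Y => //; rewrite setTI.
Qed.

Lemma measurable_fun_rV d (T : measurableType d) {R : realType} n
    (f : T -> 'rV[R]_n) :
  (forall i, measurable_fun [set: T] (fun x => f x 0 i)) ->
  measurable_fun [set: T] f.
Proof.
move=> mf.
apply: (measurability (\big[setU/set0]_(i < n)
  preimage_set_system setT (fun v : 'rV[R]_n => v 0 i) measurable)) => //.
move=> _ [A + <-].
rewrite -bigcup_seq => -[i _ [B mB <-]].
by rewrite setTI; have := mf i measurableT _ mB; rewrite !setTI.
Qed.

Section lebesgue_measure_rV.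
Context {R : realType}.

Definition rV_cons n (p : measurableTypeR R * 'rV[R]_n) : 'rV[R]_n.+1 :=
  row_mx (p.1)%:M p.2.

Let rV_uncons n (v : 'rV[R]_n.+1) : measurableTypeR R * 'rV[R]_n :=
  (v 0 ord0, \row_j v 0 (lift ord0 j)).

Lemma rV_cons0 n (p : measurableTypeR R * 'rV[R]_n) : rV_cons p 0 ord0 = p.1.
Proof.
rewrite mxE; case: splitP => // j _.
by rewrite !ord1 mxE eqxx mulr1n.
Qed.

Lemma rV_consS n (p : measurableTypeR R * 'rV[R]_n) j :
  rV_cons p 0 (lift ord0 j) = p.2 0 j.
Proof.
rewrite mxE; case: splitP => [k|k] /=; rewrite /bump /= add1n.
  by rewrite ord1.
by case=> /val_inj ->.
Qed.

Let rV_consK n : cancel (@rV_cons n) (@rV_uncons n).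
Proof.
case=> x v; rewrite /rV_uncons rV_cons0; congr pair.
by apply/rowP => j; rewrite mxE rV_consS.
Qed.

Lemma measurable_rV_cons n :
  measurable_fun [set: measurableTypeR R * 'rV[R]_n] (@rV_cons n).
Proof.
apply: measurable_fun_rV => i; case: (unliftP ord0 i) => [j|] ->.
  rewrite (_ : (fun _ => _) = fun p : measurableTypeR R * 'rV[R]_n => p.2 0 j).
    exact: (measurableT_comp (measurable_coord j)).
  by apply/funext => p; rewrite rV_consS.
rewrite (_ : (fun _ => _) = (fst : measurableTypeR R * 'rV[R]_n -> R)).
  exact: (@measurable_fst _ _ (measurableTypeR R) 'rV[R]_n).
by apply/funext => p; rewrite rV_cons0.
Qed.

Let measurable_rV_uncons n : measurable_fun [set: 'rV[R]_n.+1] (@rV_uncons n).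
Proof.
apply: measurable_fun_pair; first exact: measurable_coord.
apply: measurable_fun_rV => i.
rewrite (_ : (fun _ => _) = fun v : 'rV[R]_n.+1 => v 0 (lift ord0 i)).
  exact: measurable_coord.
by apply/funext => v; rewrite mxE.
Qed.

Local Open Scope ereal_scope.

(* n-dimensional Lebesgue measure: the n-fold product of the Lebesgue measure
   on the line (a unit mass at the only point when n = 0). *)
Fixpoint lebesgue_rV (n : nat) : set 'rV[R]_n -> \bar R :=
  match n with
  | 0 => \d_(0%R : 'rV[R]_0)
  | m.+1 => pushforward (@lebesgue_measure R \x @lebesgue_rV m) (@rV_cons m)
  end.

Section lebesgue_rV_step.
Variables (n : nat) (nu : {sigma_finite_measure set 'rV[R]_n -> \bar R}).

Let step : set 'rV[R]_n.+1 -> \bar R :=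
  pushforward (@lebesgue_measure R \x nu) (@rV_cons n).

Let step0 : step set0 = 0.
Proof. by rewrite /step /pushforward preimage_set0 measure0. Qed.

Let step_ge0 A : 0 <= step A.
Proof. by rewrite /step /pushforward measure_ge0. Qed.

Let step_sigma_additive : semi_sigma_additive step.
Proof.
exact: (@measure_semi_sigma_additive _ _ _
  (measure_function_pushforward__canonical__measure_function_Measure
    _ (@measurable_rV_cons n))).
Qed.

HB.instance Definition _ :=
  isMeasure.Build _ _ _ step step0 step_ge0 step_sigma_additive.

Let step_sigma_finite : sigma_finite setT step.
Proof.
have /sigma_finiteP[F [TF ndF Foo]] := sigma_finiteT (@lebesgue_measure R).
have /sigma_finiteP[G [TG ndG Goo]] := sigma_finiteT nu.
exists (fun k => @rV_uncons n @^-1` (F k `*` G k)).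
  rewrite -preimage_bigcup (_ : \bigcup_k _ = setT) ?preimage_setT//.
  rewrite -setXTT TF TG predeqE => -[x y]; split.
    by move=> [k _ []/= ? ?]; split; exists k.
  move=> [/= [k _ Fkx] [l _ Gly]]; exists (maxn k l) => //; split.
  - by move: x Fkx; exact/subsetPset/ndF/leq_maxl.
  - by move: y Gly; exact/subsetPset/ndG/leq_maxr.
move=> k; have [mF Fk] := Foo k; have [mG Gk] := Goo k; split.
  rewrite -[X in measurable X]setTI; apply: measurable_rV_uncons => //.
  exact: measurableX.
rewrite /step /pushforward -comp_preimage.
rewrite (_ : _ \o _ = id); last first.
  by apply/funext => p /=; rewrite rV_consK.
by rewrite product_measure1E// lte_mul_pinfty// ge0_fin_numE.
Qed.

HB.instance Definition _ :=
  Measure_isSigmaFinite.Build _ _ _ step step_sigma_finite.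

Definition lebesgue_rV_step : {sigma_finite_measure set _ -> \bar R} := step.

End lebesgue_rV_step.

Let lebesgue_rV_sfm n :
  exists nu : {sigma_finite_measure set 'rV[R]_n -> \bar R},
    @lebesgue_rV n = nu.
Proof.
elim: n => [|n [nu nuE]]; first by exists \d_(0%R : 'rV[R]_0).
by exists (lebesgue_rV_step nu); rewrite /= nuE.
Qed.

Let lebesgue_rV0 n : @lebesgue_rV n set0 = 0.
Proof. by have [nu ->] := lebesgue_rV_sfm n; exact: measure0. Qed.

Let lebesgue_rV_ge0 n A : 0 <= @lebesgue_rV n A.
Proof. by have [nu ->] := lebesgue_rV_sfm n; exact: measure_ge0. Qed.

Let lebesgue_rV_sigma_additive n : semi_sigma_additive (@lebesgue_rV n).
Proof.
by have [nu ->] := lebesgue_rV_sfm n; exact: measure_semi_sigma_additive.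
Qed.

HB.instance Definition _ n := isMeasure.Build _ _ _ (@lebesgue_rV n)
  (lebesgue_rV0 n) (@lebesgue_rV_ge0 n) (@lebesgue_rV_sigma_additive n).

Let lebesgue_rV_sigma_finite n : sigma_finite setT (@lebesgue_rV n).
Proof. by have [nu ->] := lebesgue_rV_sfm n; exact: sigma_finiteT. Qed.

HB.instance Definition _ n := Measure_isSigmaFinite.Build _ _ _
  (@lebesgue_rV n) (@lebesgue_rV_sigma_finite n).

Lemma lebesgue_rV_prod n (A : 'I_n -> set R) :
  (forall i, measurable (A i)) ->
  lebesgue_rV [set v | forall i, A i (v 0%R i)] =
  \prod_(i < n) lebesgue_measure (A i).
Proof.
elim: n A => [|n IHn] A mA.
  rewrite big_ord0 /= diracE mem_set//.
  by case.
have mB : measurable [set v : 'rV[R]_n | forall i, A (lift ord0 i) (v 0%R i)].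
  rewrite (_ : mkset _ = \big[setI/setT]_(i < n)
      ((fun v : 'rV[R]_n => v 0%R i) @^-1` A (lift ord0 i))).
    apply: bigsetI_measurable => i _; rewrite -[X in measurable X]setTI.
    exact: measurable_coord.
  apply/seteqP; split => v /=; rewrite -bigcap_seq /=.
    by move=> Av i _; exact: Av.
  by move=> Av i; apply: Av; rewrite /= mem_index_enum.
rewrite big_ord_recl -IHn// -product_measure1E//= /pushforward /=.
congr (product_measure1 _ _ _).
apply/seteqP; split => [p /= Ap|p /= [Ap0 ApS] i].
  split; first by have := Ap ord0; rewrite rV_cons0.
  by move=> i; have := Ap (lift ord0 i); rewrite rV_consS.
case: (unliftP ord0 i) => [j|] ->; first by rewrite rV_consS.
by rewrite rV_cons0.
exact: mA.
Qed.

End lebesgue_measure_rV.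

Section convex_body.
Context {R : realType} (n : nat).
Implicit Type K : set 'rV[R]_n.

Definition convex_body K : Prop :=
  [/\ compact K, convex_set (K : set (convex_lmodType 'rV[R]_n)) &
      K° !=set0].

(* The vector-valued integral, taken coordinate by coordinate. *)
Definition integral_rV K m (f : 'rV[R]_n -> 'rV[R]_m) : 'rV[R]_m :=
  \row_i (\int[@lebesgue_rV R n]_(x in K) f x 0 i).

Definition centroid_at_origin K : Prop := integral_rV K id = 0.

End convex_body.

(* Main.v *)
Require Import Defs.
From mathcomp Require Import all_boot all_order all_algebra.
From mathcomp Require Import all_classical all_reals all_analysis.
From mathcomp Require Import finmap measurable_realfun lra ring.

(** For [x0] in [K], the point [- x0 / n] has to be in [K], and this can be tested
against linear functionals: a point outside the compact convex set [K] is
strictly separated from it ([separate_point]), so the claim is that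
[- dot u x0 <= n * b] whenever [dot u <= b] on [K] ([centroid_dot_ineq]).

For [0 < t < 1], let [T x = (1 - t) x0 + t x] be the homothety of centre [x0]
and ratio [t].  Convexity gives [T K `<=` K], and [b - dot u] is nonnegative on
[K], so its integral over [K] is at least its integral over [T K].  Both are
explicit.  Since the centroid is at the origin, [dot u] integrates to 0 over [K],
and the first integral is [b * V] with [V] the volume of [K].  Substituting [T],
which multiplies volumes by [t ^+ n], the second one is
[t ^+ n * (b - (1 - t) * dot u x0) * V].  As [0 < V < +oo],
[[
    t ^+ n * (b - (1 - t) * dot u x0) <= b,
]]
which is [homothety_ineq].  Subtracting [t ^+ n * b], dividing by [1 - t] and
letting [t] tend to 1 yields [- dot u x0 <= n * b].

The substitution rule rests on the scaling law of the [n]-dimensional measure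
([lebesgue_rV_affine]), which is checked on boxes and extended to all measurable
sets by uniqueness of measures. *)

Set Implicit Arguments.
Unset Strict Implicit.
Unset Printing Implicit Defensive.

Import Order.TTheory GRing.Theory Num.Theory.
Import numFieldNormedType.Exports.
Local Open Scope classical_set_scope.
Local Open Scope ring_scope.

(** * Behaviour of Lebesgue measure under homotheties *)

Lemma measurable_affine (R : realType) (a t : R) :
  measurable_fun [set: measurableTypeR R]
    (fun x : measurableTypeR R => a + t * x : measurableTypeR R).
Proof.
apply: (@measurable_funD _ (measurableTypeR R) R setT (cst a) ( *%R t)).
  exact: measurable_cst.
exact: mulrl_measurable.
Qed.

(** By uniqueness of Lebesgue measure, it suffices to compare both sides on
half-open intervals. *)
Lemma lebesgue_measure_affine (R : realType) (a t : R) (A : set R) :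
  0 < t -> measurable A ->
  lebesgue_measure ((fun x => a + t * x) @^-1` A) =
  (t^-1%:E * lebesgue_measure A)%E.
Proof.
move=> t0 mA; pose tn := NngNum (ltW t0).
pose nu := mscale tn
  (measure_function_pushforward__canonical__measure_function_Measure
    (@lebesgue_measure R) (measurable_affine a t)).
have nuE X : nu X =
    (t%:E * lebesgue_measure ((fun x => a + t * x)%R @^-1` X))%E by [].
have -> : lebesgue_measure A = nu A.
  apply: lebesgue_measure_unique => // _ [[x y] _ <-].
  rewrite [RHS]nuE.
  rewrite (_ : (_ @^-1` _)%classic =
      `](x - a) / t, (y - a) / t]%classic); last first.
    apply/seteqP; split=> z /=; rewrite !in_itv /=;
    by rewrite ltr_pdivrMr// ler_pdivlMr// ltrBlDl lerBrDl (mulrC t).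
  rewrite !lebesgue_measure_itv /= !lte_fin ltr_pM2r ?invr_gt0// ltrD2r.
  case: ifP => _; last by rewrite mule0.
  by rewrite -!EFinB -EFinM; congr EFin; field; rewrite gt_eqF.
by rewrite nuE muleA -EFinM mulVf ?mul1e// gt_eqF.
Qed.

Section box.
Context {R : realType} (n : nat).
Implicit Type A : 'I_n -> set R.

Definition box A : set 'rV[R]_n := [set v | forall i, A i (v 0 i)].

Lemma measurable_box A : (forall i, measurable (A i)) -> measurable (box A).
Proof.
move=> mA; rewrite (_ : box A = \big[setI/setT]_(i < n)
      ((fun v : 'rV[R]_n => v 0%R i) @^-1` A i)).
  apply: bigsetI_measurable => i _; rewrite -[X in measurable X]setTI.
  exact: measurable_coord.
apply/seteqP; split => v /=; rewrite -bigcap_seq /=.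
  by move=> Av i _; exact: Av.
by move=> Av i; apply: Av; rewrite /= mem_index_enum.
Qed.

(** A pi-system on which the measure is given by the product formula and which
generates the sigma-algebra: it is where two measures get compared. *)
Definition boxes : set (set 'rV[R]_n) :=
  [set box A | A in [set A | forall i, measurable (A i)]].

Lemma measurable_rV_boxes : @measurable _ 'rV[R]_n = <<s boxes >>.
Proof.
apply/seteqP; split; last first.
  apply: smallest_sub; first exact: sigma_algebra_measurable.
  by move=> _ [A mA <-]; exact: measurable_box.
apply: smallest_sub; first exact: smallest_sigma_algebra.
move=> B; rewrite -bigcup_seq => -[i _ [C mC <-]]; rewrite setTI.
apply: sub_sigma_algebra; exists (fun j => if j == i then C else setT).
  by move=> j /=; case: ifP.
apply/seteqP; split=> v /=; first by move=> /(_ i); rewrite eqxx.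
by move=> Cv j; case: eqP => // ->.
Qed.

End box.

Lemma normr_coord_le (R : realType) n (x : 'rV[R]_n) i : `|x 0 i| <= `|x|.
Proof.
rewrite [leRHS]/Num.Def.normr/= mx_normrE.
by apply/bigmax_geP; right; exists (0, i).
Qed.

Lemma lebesgue_rV_box (R : realType) n (A : 'I_n -> set R) :
  (forall i, measurable (A i)) ->
  lebesgue_rV (box A) = (\prod_(i < n) lebesgue_measure (A i))%E.
Proof. exact: lebesgue_rV_prod. Qed.

Lemma lebesgue_rV_box_lty (R : realType) n (A : 'I_n -> set R) :
  (forall i, measurable (A i)) ->
  (forall i, lebesgue_measure (A i) < +oo)%E ->
  (lebesgue_rV (box A) < +oo)%E.
Proof.
move=> mA Aoo; rewrite -ge0_fin_numE ?measure_ge0// lebesgue_rV_box//.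
apply: (big_ind (fun x : \bar R => x \is a fin_num)) => //.
  by move=> *; exact: fin_numM.
by move=> i _; rewrite ge0_fin_numE.
Qed.

Section affine.
Context {R : realType} (n : nat).
Implicit Types (a x : 'rV[R]_n) (t : R).

Lemma measurable_fun_rV_affine a t :
  measurable_fun [set: 'rV[R]_n] (fun x : 'rV[R]_n => a + t *: x : 'rV[R]_n).
Proof.
apply: measurable_fun_rV => i.
rewrite (_ : (fun _ => _) = (fun x : 'rV[R]_n => a 0 i + t * x 0 i)).
  apply: (@measurable_funD _ 'rV[R]_n R setT (cst (a 0 i))).
    exact: measurable_cst.
  apply: (@measurable_funM _ 'rV[R]_n R setT (cst t)).
    exact: measurable_cst.
  exact: measurable_coord.
by apply/funext => x; rewrite !mxE.
Qed.

(** On a box the map acts coordinatewise, so the one-dimensional law gives a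
factor [t^-1] for each of the [n] sides; both sides are measures that are finite
on the cubes [`]-k, k]^n], hence they agree everywhere. *)
Lemma lebesgue_rV_affine a t (A : set 'rV[R]_n) : 0 < t -> measurable A ->
  pushforward (@lebesgue_rV R n) (fun x => a + t *: x) A =
  (((t ^+ n)^-1)%:E * lebesgue_rV A)%E.
Proof.
move=> t0 mA.
have tn0 : 0 <= (t ^+ n)^-1 by rewrite invr_ge0 exprn_ge0// ltW.
pose tn := NngNum tn0.
pose nu := measure_function_pushforward__canonical__measure_function_Measure
    (@lebesgue_rV R n) (measurable_fun_rV_affine a t).
pose mu := mscale tn (@lebesgue_rV R n).
have muE B : mu B = ((t ^+ n)^-1%:E * lebesgue_rV B)%E by [].
pose g k : set 'rV[R]_n := box (fun=> `](- k%:R)%R, k%:R]%classic).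
have nuE B : (forall i, measurable (B i)) -> nu (box B) = mu (box B).
  move=> mB.
  have -> : nu (box B) =
      lebesgue_rV (box (fun i => (fun y : R => a 0 i + t * y) @^-1` (B i))).
    rewrite [LHS]/(lebesgue_rV _); congr lebesgue_rV.
    by apply/seteqP; split=> x /= Bx i; have := Bx i; rewrite !mxE.
  rewrite lebesgue_rV_box; last first.
    move=> i; have := @measurable_affine R (a 0 i) t measurableT _ (mB i).
    by rewrite setTI.
  rewrite muE lebesgue_rV_box//.
  rewrite (eq_bigr (fun i => t^-1%:E * lebesgue_measure (B i))%E); last first.
    by move=> i _; rewrite lebesgue_measure_affine.
  rewrite big_split/=; congr (_ * _)%E.
  by rewrite prodEFin prodr_const card_ord exprVn.
change (nu A = mu A).
apply: (@measure_unique _ R _ (@boxes R n) g (@measurable_rV_boxes R n)) => //.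
- move=> _ _ [B mB <-] [C mC <-]; exists (fun i => B i `&` C i).
    by move=> i; apply: measurableI; [exact: mB|exact: mC].
  apply/seteqP; split=> x /=.
    by move=> BC; split=> i; have [] := BC i.
  by move=> [Bx Cx] i; split; [exact: Bx|exact: Cx].
- by move=> k; exists (fun=> `](- k%:R)%R, k%:R]%classic).
- apply/seteqP; split=> // x _; exists (Num.truncn `|x|).+1 => // i /=.
  have := le_lt_trans (normr_coord_le x i) (truncnS_gt `|x|).
  by rewrite in_itv/= ltr_norml => /andP[-> /ltW ->].
- by move=> _ [B mB <-]; exact: nuE.
- move=> k; rewrite nuE// muE lte_mul_pinfty ?lee_fin//.
  apply: lebesgue_rV_box_lty => // i.
  by rewrite lebesgue_measure_itv; case: ifP => _ //=; rewrite ltry.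
Qed.

(** Change of variables: the scaling law read as an equality between the
measure and a multiple of its pushforward. *)
Lemma ge0_integral_rV_affine a t (D : set 'rV[R]_n) (f : 'rV[R]_n -> \bar R) :
  0 < t -> measurable D -> measurable_fun D f ->
  (forall x, D x -> 0 <= f x)%E ->
  (\int[@lebesgue_rV R n]_(x in D) f x = (t ^+ n)%:E *
   \int[@lebesgue_rV R n]_(x in (fun x : 'rV[R]_n => a + t *: x)%R @^-1` D)
      f (a + t *: x)%R)%E.
Proof.
move=> t0 mD mf f0.
have := ge0_integral_pushforward (measurable_fun_rV_affine a t)
  (@lebesgue_rV R n) mD mf.
move=> /(_ (fun x Dx => f0 x (set_mem Dx)))/=<-.
have tn0 : 0 <= (t ^+ n)^-1 by rewrite invr_ge0 exprn_ge0// ltW.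
transitivity ((t ^+ n)%:E *
    \int[mscale (NngNum tn0) (@lebesgue_rV R n)]_(x in D) f x)%E.
  rewrite ge0_integral_mscale// muleA -EFinM divff ?mul1e//.
  by rewrite gt_eqF// exprn_gt0.
congr (_ * _)%E; apply: (eq_measure_integral
  (measure_function_pushforward__canonical__measure_function_Measure
    (@lebesgue_rV R n) (measurable_fun_rV_affine a t))) => A mA _.
by have /esym := lebesgue_rV_affine a t0 mA.
Qed.
End affine.

(** * Measure of compact sets *)

(** Balls of the sup norm are boxes; the bound on [e] is needed in dimension 0,
where a box is the whole space whatever its sides. *)
Lemma ball_rVE (R : realType) n (x : 'rV[R]_n) (e : R) : 0 < e ->
  ball x e = box (fun i => ball (x 0 i) e).
Proof.
move=> e0; apply/seteqP; split=> y; first by move=> [_ xy] i; exact: xy.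
by move=> xy; split=> // i j; rewrite (ord1 i); exact: xy.
Qed.

(** The sigma-algebra is generated by coordinates and not by open sets.  A compact
set is the intersection over [k] of finite unions of balls of radius [1/(k+1)]
centred in it, and those balls are boxes. *)
Lemma compact_measurable_rV (R : realType) n (K : set 'rV[R]_n) :
  compact K -> measurable K.
Proof.
move=> cK.
have e_gt0 k : 0 < k.+1%:R^-1 :> R by rewrite invr_gt0 ltr0n.
have cov k : exists D : {fset 'rV[R]_n},
    K `<=` \bigcup_(x in [set` D]) ball x k.+1%:R^-1 /\ {subset D <= K}.
  move: (cK); rewrite compact_cover => /(_ _ K (fun x => ball x k.+1%:R^-1)).
  case.
  - by move=> x _; exact: ball_open.
  - by move=> x Kx; exists x => //; exact: ballxx.
  - by move=> D DK KD; exists D.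
have [D /all_and2[KD DK]] := choice cov.
rewrite (_ : K = \bigcap_k \bigcup_(x in [set` D k]) ball x k.+1%:R^-1).
  apply: bigcapT_measurable => k; apply: fin_bigcup_measurable.
    exact: finite_fset.
  move=> x _; rewrite ball_rVE//; apply: measurable_box => i.
  exact: measurable_ball.
apply/seteqP; split=> [x Kx k _|x Dx]; first exact: KD.
have : closed K by apply: compact_closed => //; exact: norm_hausdorff.
apply=> B /nbhs_ballP[e /= e0 xeB].
have [k ke] : exists k, k.+1%:R^-1 < e.
  exists (Num.truncn e^-1).
  by rewrite invf_plt ?posrE// ?truncnS_gt// ltr0n.
have [y Dy yx] := Dx k I.
exists y; split; first exact/set_mem/(DK k).
by apply/xeB/(le_ball (ltW ke))/ball_sym.
Qed.

Lemma compact_lebesgue_rV_lty (R : realType) n (K : set 'rV[R]_n) :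
  compact K -> (lebesgue_rV K < +oo)%E.
Proof.
move=> cK; have [M M0 KM] := ex_strict_bound_gt0 (compact_bounded cK).
have mB (i : 'I_n) : measurable (`[- M, M]%classic : set R) by [].
apply: (@le_lt_trans _ _ (lebesgue_rV (box (fun=> `[- M, M]%classic)))).
  apply: le_measure.
  - by apply: mem_set; exact: compact_measurable_rV cK.
  - by apply: mem_set; exact: measurable_box mB.
  - move=> x /KM/= xM i /=; rewrite in_itv/= -ler_norml.
    by rewrite (le_trans (normr_coord_le x i))// ltW.
apply: lebesgue_rV_box_lty => // i.
by rewrite lebesgue_measure_itv; case: ifP => _ //=; rewrite ltry.
Qed.

Lemma interior_lebesgue_rV_gt0 (R : realType) n (K : set 'rV[R]_n) :
  measurable K -> K° !=set0 -> (0 < lebesgue_rV K)%E.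
Proof.
move=> mK [x /nbhs_ballP[e /= e0 xeK]].
have mB i : measurable (ball (x 0 i) e : set R) by exact: measurable_ball.
apply: (@lt_le_trans _ _ (lebesgue_rV (ball x e))).
  rewrite ball_rVE// lebesgue_rV_box//.
  apply: (big_ind (fun y : \bar R => (0 < y)%E)) => //.
    by move=> *; exact: mule_gt0.
  by move=> i _; rewrite lebesgue_measure_ball ?ltW// lte_fin mulrn_wgt0.
apply: le_measure => //; apply/mem_set => //; rewrite ball_rVE//.
exact: measurable_box.
Qed.

(** * Separation of a point from a compact convex set *)

Section dot.
Context {R : realType} (n : nat).
Implicit Types u x y : 'rV[R]_n.

Definition dot u x : R := \sum_i u 0 i * x 0 i.

Lemma dotC u x : dot u x = dot x u.
Proof. by apply: eq_bigr => i _; rewrite mulrC. Qed.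

Lemma dotDr u x y : dot u (x + y) = dot u x + dot u y.
Proof. by rewrite -big_split; apply: eq_bigr => i _; rewrite mxE mulrDr. Qed.

Lemma dotZr u t x : dot u (t *: x) = t * dot u x.
Proof. by rewrite mulr_sumr; apply: eq_bigr => i _; rewrite mxE mulrCA. Qed.

Lemma dotNr u x : dot u (- x) = - dot u x.
Proof. by rewrite -scaleN1r dotZr mulN1r. Qed.

Lemma dotDl u x y : dot (x + y) u = dot x u + dot y u.
Proof. by rewrite dotC dotDr !(dotC u). Qed.

Lemma dotZl u t x : dot (t *: x) u = t * dot x u.
Proof. by rewrite dotC dotZr (dotC u). Qed.

Lemma dotNl u x : dot (- x) u = - dot x u.
Proof. by rewrite dotC dotNr (dotC u). Qed.

Lemma dot_sqr_sub (s : R) u x :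
  dot (s *: x - u) (s *: x - u) = s ^+ 2 * dot x x - 2 * s * dot u x + dot u u.
Proof.
rewrite !(dotDl, dotDr, dotNl, dotNr, dotZl, dotZr) (dotC x u); ring.
Qed.

Lemma dot_self_ge0 u : 0 <= dot u u.
Proof. by apply: sumr_ge0 => i _; rewrite -expr2 sqr_ge0. Qed.

Lemma dot_self_gt0 u : u != 0 -> 0 < dot u u.
Proof.
move=> u0; rewrite lt_neqAle dot_self_ge0 andbT eq_sym; apply: contra u0.
rewrite psumr_eq0 => [/allP u0|i _]; last by rewrite -expr2 sqr_ge0.
apply/eqP/rowP => i; rewrite mxE; apply/eqP.
by have := u0 i (mem_index_enum _); rewrite /= mulf_eq0 orbb.
Qed.

Lemma continuous_dot_sub u : continuous (fun x => dot (x - u) (x - u)).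
Proof.
apply: continuous_big => [|i _]; first exact: add_continuous.
have ci : continuous (fun x => (x - u) 0 i).
  rewrite (_ : (fun _ => _) = fun x => x 0 i - u 0 i); last first.
    by apply/funext => x; rewrite !mxE.
  move=> x; apply: continuousB; first exact: coord_continuous.
  exact: cst_continuous.
by move=> x; apply: continuousM; exact: ci.
Qed.

Lemma convex_set_segment (K : set 'rV[R]_n) x y (t : R) :
  convex_set (K : set (convex_lmodType 'rV[R]_n)) -> 0 <= t <= 1 ->
  K x -> K y -> K (t *: x + (1 - t) *: y).
Proof.
move=> cK /andP[t0 t1] Kx Ky.
have ti : Itv.spec (@Itv.num_sem R) (Itv.Real `[0%Z, 1%Z]) t.
  by rewrite /= /Itv.num_sem/= in_itv/= t0 t1 ger0_real.
by have /set_mem := cK x y (Itv.mk ti) (mem_set Kx) (mem_set Ky).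
Qed.

(** If [c] is the point of [K] nearest to [p] for the Euclidean distance, the
hyperplane through [c] orthogonal to [p - c] separates: moving from [c] towards a
point [x] of [K] with [dot (p - c) (x - c) > 0] would bring [c] closer to [p]. *)
Lemma separate_point (K : set 'rV[R]_n) p : compact K -> K !=set0 ->
  convex_set (K : set (convex_lmodType 'rV[R]_n)) -> ~ K p ->
  exists u b, (forall x, K x -> dot u x <= b) /\ b < dot u p.
Proof.
move=> cK K0 convK Kp.
have [c /set_mem Kc cmin] := EVT_min_rV K0 cK
  (continuous_subspaceT (@continuous_dot_sub p)).
pose u := p - c; exists u, (dot u c); split; last first.
  rewrite -subr_gt0 -dotNr -dotDr dot_self_gt0// subr_eq0.
  by apply/eqP => pc; apply: Kp; rewrite pc.
move=> x Kx; rewrite -subr_le0 -dotNr -dotDr; set w := x - c.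
rewrite leNgt; apply/negP => A0; have q0 := dot_self_ge0 w.
set A := dot u w in A0 *; set q := dot w w in q0 *.
have Aq : 0 < A + q by exact: ltr_wpDr.
(* A step short enough for the gain [2 s A] to beat the loss [s^2 q]. *)
have s01 : 0 <= A / (A + q) <= 1.
  apply/andP; split; first by rewrite divr_ge0// ltW.
  by rewrite ler_pdivrMr// mul1r lerDl.
have := cmin _ (mem_set (convex_set_segment convK s01 Kx Kc)).
set s := A / (A + q) in s01 *.
have -> : s *: x + (1 - s) *: c - p = s *: w - u.
  by rewrite /w /u scalerBr scalerBl scale1r opprB [c - _]addrC !addrA.
have -> : c - p = - u by rewrite opprB.
rewrite dot_sqr_sub dotNl dotNr opprK -/A -/q.
have sE : s * (A + q) = A by rewrite divfK// gt_eqF.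
have s0 : 0 < s by rewrite divr_gt0.
nra.
Qed.

End dot.

(** * Integrals of affine functionals over a centred compact set *)

Section integral_dot.
Context {R : realType} (n : nat) (K : set 'rV[R]_n) (cK : compact K).
Let mK := compact_measurable_rV cK.
Notation mu := (@lebesgue_rV R n).

Lemma integrable_coord i : mu.-integrable K (fun x : 'rV[R]_n => (x 0 i)%:E).
Proof.
apply: measurable_bounded_integrable => //.
- exact: compact_lebesgue_rV_lty.
- apply: measurable_funTS; exact: measurable_coord.
have [M [Mr KM]] := compact_bounded cK; exists M; split=> // N MN x Kx.
exact: le_trans (normr_coord_le x i) (KM N MN x Kx).
Qed.

Let dotE (u x : 'rV[R]_n) :
  (dot u x)%:E = (\sum_i ((u 0 i)%:E * (x 0 i)%:E))%E.
Proof. by rewrite -sumEFin. Qed.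

Lemma integrable_dot u : mu.-integrable K (fun x => (dot u x)%:E).
Proof.
apply: (eq_integrable mK (fun x : 'rV[R]_n =>
    \sum_i ((u 0%R i)%:E * (x 0%R i)%:E))%E).
  by move=> x _; rewrite dotE.
apply: integrable_sum => // i _; apply: integrableZl => //.
exact: integrable_coord.
Qed.

Lemma integral_dot_centroid u : centroid_at_origin K ->
  (\int[mu]_(x in K) (dot u x)%:E = 0)%E.
Proof.
move=> /rowP K0; under eq_integral do rewrite dotE.
rewrite integral_sum//; last first.
  by move=> i; apply: integrableZl => //; exact: integrable_coord.
rewrite big1// => i _; rewrite integralZl//; last exact: integrable_coord.
have := K0 i; rewrite !mxE /Rintegral => Ki.
rewrite -[X in (_ * X)%E]fineK ?Ki ?mule0// integrable_fin_num//.
exact: integrable_coord.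
Qed.

Lemma integrable_cst_compact c : mu.-integrable K (EFin \o cst c).
Proof.
apply: measurable_bounded_integrable => //.
- exact: compact_lebesgue_rV_lty.
by exists `|c|; split; [exact: num_real|move=> N cN x _; exact: ltW].
Qed.

Lemma integral_cst_sub_dot u c t : centroid_at_origin K ->
  (\int[mu]_(x in K) (c - t * dot u x)%:E = c%:E * mu K)%E.
Proof.
move=> K0; under eq_integral do rewrite EFinB.
rewrite integralB_EFin//=; last 2 first.
- exact: integrable_cst_compact.
- apply: (@integrableZl _ _ _ mu K mK t (fun x => (dot u x)%:E)).
  exact: integrable_dot.
rewrite integral_cst//; under [X in (_ - X)%E]eq_integral do rewrite EFinM.
rewrite integralZl// ?integral_dot_centroid ?mule0 ?sube0//.
exact: integrable_dot.
Qed.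

End integral_dot.

(** * The centroid inequality *)

Lemma bernoulli_ineq (R : realFieldType) n (e : R) : 0 <= e <= 1 ->
  1 - n%:R * e <= (1 - e) ^+ n.
Proof.
move=> /andP[e0 e1]; elim: n => [|n IH]; first by rewrite mul0r subr0.
rewrite exprS; apply: (@le_trans _ _ ((1 - e) * (1 - n%:R * e))).
  have : 0 <= n%:R * e * e by rewrite !mulr_ge0.
  by rewrite -natr1; nra.
by rewrite ler_wpM2l// subr_ge0.
Qed.

Section centroid.
Context {R : realType} (n : nat) (K : set 'rV[R]_n).
Context (bK : convex_body K) (cK : centroid_at_origin K).
Notation mu := (@lebesgue_rV R n).

(** Compare the integrals of [b - dot u] over [K] and over its image under the
homothety of centre [x0] and ratio [t]. *)
Lemma homothety_ineq (u x0 : 'rV[R]_n) (b t : R) :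
  K x0 -> (forall x, K x -> dot u x <= b) -> 0 < t <= 1 ->
  t ^+ n * (b - (1 - t) * dot u x0) <= b.
Proof.
case: bK => Kcomp Kconv Kint Kx0 ub /andP[t0 t1].
have mK := compact_measurable_rV Kcomp.
have Kpos := interior_lebesgue_rV_gt0 mK Kint.
have Kfin := compact_lebesgue_rV_lty Kcomp.
pose T (x : 'rV[R]_n) := (1 - t) *: x0 + t *: x.
pose T' (y : 'rV[R]_n) := (- (t^-1 * (1 - t))) *: x0 + t^-1 *: y.
have TK y : T (T' y) = y.
  rewrite /T /T' scalerDr !scalerA mulrN mulVKf ?gt_eqF// divff ?gt_eqF//.
  by rewrite scaleNr addNKr scale1r.
have T'K x : T' (T x) = x.
  rewrite /T /T' scalerDr !scalerA mulVf ?gt_eqF//.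
  by rewrite scaleNr addKr scale1r.
(* [S] is [T K], written as a preimage so that its measurability is clear. *)
pose S : set 'rV[R]_n := T' @^-1` K.
have mS : measurable S.
  by rewrite -[S]setTI; exact: measurable_fun_rV_affine.
have SK : S `<=` K.
  move=> y Sy; rewrite -(TK y) /T addrC.
  by apply: convex_set_segment => //; rewrite (ltW t0).
(* The factor 1 makes [b - dot u] an instance of [integral_cst_sub_dot]. *)
have mh (D : set 'rV[R]_n) : measurable_fun D (fun x => (b - 1 * dot u x)%:E).
  apply/measurable_EFinP; apply: (@measurable_funB _ 'rV[R]_n R D (cst b)).
    exact: measurable_cst.
  apply: (@measurable_funM _ 'rV[R]_n R D (cst 1)); first exact: measurable_cst.
  apply: measurable_sum => i.
  apply: (@measurable_funM _ 'rV[R]_n R D (cst (u 0 i))).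
    exact: measurable_cst.
  by apply: measurable_funTS; exact: measurable_coord.
have h0 x : K x -> (0 <= (b - 1 * dot u x)%:E)%E.
  by move=> Kx; rewrite lee_fin mul1r subr_ge0 ub.
have := ge0_subset_integral mu mS mK (mh K) h0 SK.
rewrite (integral_cst_sub_dot Kcomp u b 1 cK).
have hS x (Sx : S x) := h0 x (SK x Sx).
rewrite (ge0_integral_rV_affine ((1 - t) *: x0) t0 mS (mh S) hS).
have -> : (fun x : 'rV[R]_n => (1 - t) *: x0 + t *: x) @^-1` S = K.
  by apply/seteqP; split=> x; rewrite /S /= T'K.
rewrite (eq_integral
  (fun x => (b - (1 - t) * dot u x0 - t * dot u x)%:E)); last first.
  by move=> x _; rewrite dotDr !dotZr; congr EFin; ring.
rewrite integral_cst_sub_dot// muleA -EFinM.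
by rewrite lee_pmul2r// ge0_fin_numE.
Qed.

Lemma centroid_dot_ge0 (u : 'rV[R]_n) (b : R) :
  (forall x, K x -> dot u x <= b) -> 0 <= b.
Proof.
case: bK => Kcomp _ Kint ub.
have Kpos := interior_lebesgue_rV_gt0 (compact_measurable_rV Kcomp) Kint.
have : (0 <= \int[mu]_(x in K) (b - 1 * dot u x)%:E)%E.
  by apply: integral_ge0 => x Kx; rewrite lee_fin mul1r subr_ge0 ub.
by rewrite integral_cst_sub_dot// pmule_lge0// lee_fin.
Qed.

(** The limit [t -> 1] in [homothety_ineq], with [e = 1 - t] and the Bernoulli
inequality to bound [(1 - e) ^+ n] from below. *)
Lemma centroid_dot_ineq (u x0 : 'rV[R]_n) (b : R) :
  K x0 -> (forall x, K x -> dot u x <= b) -> - dot u x0 <= n%:R * b.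
Proof.
move=> Kx0 ub.
have hI e (e01 : 0 <= e < 1) : (1 - e) ^+ n * (b - e * dot u x0) <= b.
  have t01 : 0 < 1 - e <= 1 by lra.
  by have := homothety_ineq Kx0 ub t01; rewrite subKr.
have b0 := centroid_dot_ge0 ub.
set y := dot u x0 in hI *; have yb : y <= b by exact: ub.
set N : R := n%:R; have N0 : 0 <= N by exact: ler0n.
have [y0|y0] := leP 0 y.
  by rewrite (le_trans _ (mulr_ge0 N0 b0))// oppr_le0.
apply/ler_addgt0Pr => d d0.
(* With this [e], the error term [e * N * (- y)] is at most [d]; the 1 in the
   denominator keeps [e] below 1 when [N] is 0. *)
pose D := d - N * y + 1; have D0 : 0 < D by rewrite /D; nra.
pose e := d / D; have eD : e * D = d by rewrite divfK// gt_eqF.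
have e0 : 0 < e by rewrite divr_gt0.
have e1 : e < 1 by rewrite ltr_pdivrMr// mul1r /D; nra.
have e01 : 0 <= e < 1 by rewrite ltW.
have e01' : 0 <= e <= 1 by rewrite !ltW.
have := le_trans (ler_wpM2r _ (bernoulli_ineq n e01')) (hI e e01).
rewrite -/N => /(_ _) H.
have {}H : (1 - N * e) * (b - e * y) <= b by apply: H; nra.
have {}H : e * (- y) <= e * (N * (b - e * y)) by nra.
rewrite ler_pM2l// in H; apply: (le_trans H).
have : e * (d - N * y + 1) = d by [].
nra.
Qed.

End centroid.

Theorem theorem4p4 (R : realType) (n : nat) (K : set 'rV[R]_n) :
  convex_body K -> centroid_at_origin K ->
  [set - x | x in K] `<=` [set n%:R *: x | x in K].
Proof.
case: n K => [|n] K bK cK _ [x Kx <-].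
  by exists x => //; rewrite [LHS]thinmx0 [RHS]thinmx0.
have n0 : n.+1%:R != 0 :> R by rewrite pnatr_eq0.
exists (- n.+1%:R^-1 *: x); last by rewrite scalerA mulrN divff// scaleN1r.
apply: contrapT => Kp; case: (bK) => Kcomp Kconv _.
have [u [b [ub bp]]] := separate_point Kcomp (ex_intro _ x Kx) Kconv Kp.
have := centroid_dot_ineq bK cK Kx ub.
rewrite leNgt => /negP; apply.
by move: bp; rewrite dotZr mulNr -mulrN ltr_pdivlMl.
Qed.
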